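(* For any complex $n\times n$ matrix $X$, $$r_L(X)\le \|X\|_{(1)}=\|X\|_\infty,$$ while $$r_C(X)\le \frac{1}{\sqrt2}\,\|X\|_{(2),2}.$$
   Context: The left and Cartesian moduli are $|X|_L=(X^*X)^{1/2}$ and $|X|_C=\big((X^*X+XX^* )/2\big)^{1/2}$. For $*\in\{L,C\}$, $r_*(X)=\min_{y\in\mathbb{C}}\|\,|X-yI|_*\,\|_\infty$, with $I$ the identity matrix and $\|\cdot\|_\infty$ the operator norm. With $\sigma_1(X)\ge\sigma_2(X)\ge\dots\ge\sigma_n(X)\ge0$ the singular values of $X$ (and $\sigma_k(X)=0$ for $k>n$), $\|X\|_{(1)}=\sigma_1(X)$ and $\|X\|_{(2),2}=\big(\sigma_1(X)^2+\sigma_2(X)^2\big)^{1/2}$ (the Ky Fan $(p,k)$-norm with $p=k=2$). *)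

(* Defs.v *)
From HB Require Import structures.
From mathcomp Require Import all_boot all_order all_algebra.
From mathcomp Require Import complex.
From mathcomp Require Import boolp classical_sets reals.
From mathcomp Require Import topology normedtype derive.
Set Implicit Arguments.
Unset Strict Implicit.
Unset Printing Implicit Defensive.
Import Order.TTheory GRing.Theory Num.Theory.
Import numFieldNormedType.Exports.
Import ComplexField.Normc.
Local Open Scope ring_scope.
Local Open Scope complex_scope.
Local Open Scope sesquilinear_scope.
Local Open Scope classical_set_scope.

Definition l2norm (R : realType) (n : nat) (v : 'cV[R[i]]_n) : R :=
  Num.sqrt (\sum_(i < n) normc (v i 0) ^+ 2).

Definition opnorm (R : realType) (n : nat) (A : 'M[R[i]]_n) : R :=
  sup [set l2norm (A *m v) | v in [set v : 'cV[R[i]]_n | l2norm v <= 1]].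

(* The square root of a positive semidefinite matrix by functional calculus:
   A = U^-1 diag(d) U with U unitary gives A^(1/2) = U^-1 diag(sqrt d) U.
   [mxsqrt_psd], [mxsqrtK] and [mxsqrt_uniq] below show that this is the
   unique positive semidefinite square root of A. *)
Definition mxsqrt (C : numClosedFieldType) (n : nat) (A : 'M[C]_n) : 'M[C]_n :=
  invmx (spectralmx A) *m diag_mx (map_mx sqrtC (spectral_diag A))
    *m spectralmx A.

Definition psdmx (C : numClosedFieldType) (n : nat) (A : 'M[C]_n) : Prop :=
  A ^t* = A /\ forall v : 'cV[C]_n, 0 <= (v ^t* *m A *m v) 0 0.

Definition modulusL (R : realType) (n : nat) (X : 'M[R[i]]_n) : 'M[R[i]]_n :=
  mxsqrt (X ^t* *m X).

Definition modulusC (R : realType) (n : nat) (X : 'M[R[i]]_n) : 'M[R[i]]_n :=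
  mxsqrt (2^-1 *: (X ^t* *m X + X *m X ^t*)).

(* The infima are minima: see [radiusL_min] and [radiusC_min]. *)
Definition radiusL (R : realType) (n : nat) (X : 'M[R[i]]_n) : R :=
  inf (range (fun y : R[i] => opnorm (modulusL (X - y%:M)))).

Definition radiusC (R : realType) (n : nat) (X : 'M[R[i]]_n) : R :=
  inf (range (fun y : R[i] => opnorm (modulusC (X - y%:M)))).

(* Square roots of the eigenvalues of X^* X, with multiplicity, in
   nonincreasing order: see [char_poly_singular_values]. *)
Definition singular_values (R : realType) (n : nat) (X : 'M[R[i]]_n) : seq R :=
  sort >=%R
    [seq Num.sqrt (complex.Re (spectral_diag (X ^t* *m X) 0 i)) | i : 'I_n].

(* [sigma X k] is the k-th singular value, counted from k = 1, and 0 for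
   k > n; the index k = 0 is meaningless (it repeats k = 1). *)
Definition sigma (R : realType) (n : nat) (X : 'M[R[i]]_n) (k : nat) : R :=
  nth 0 (singular_values X) k.-1.

Definition norm_1 (R : realType) (n : nat) (X : 'M[R[i]]_n) : R := sigma X 1.

Definition norm_2_2 (R : realType) (n : nat) (X : 'M[R[i]]_n) : R :=
  Num.sqrt (sigma X 1 ^+ 2 + sigma X 2 ^+ 2).

Lemma adjmxM (C : numClosedFieldType) (m n p : nat) (A : 'M[C]_(m, n))
  (B : 'M[C]_(n, p)) : (A *m B) ^t* = B ^t* *m A ^t*.
Proof. by rewrite trmx_mul map_mxM. Qed.

Lemma psd_spectral (C : numClosedFieldType) (n : nat) (A : 'M[C]_n) : psdmx A ->
  A = invmx (spectralmx A) *m diag_mx (spectral_diag A) *m spectralmx A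
  /\ forall i, 0 <= spectral_diag A 0 i.
Proof.
move=> [Ah Ap].
have An : A \is normalmx by apply/normalmxP; rewrite Ah.
have /orthomx_spectralP E := An; split=> // i.
have Uu := spectral_unitarymx A; have Ui := spectral_unit A.
have D : diag_mx (spectral_diag A) = spectralmx A *m A *m (spectralmx A) ^t*.
  by rewrite {3}E -invmx_unitary // !mulmxA mulmxV // mul1mx mulmxK.
have := Ap ((spectralmx A) ^t* *m delta_mx i 0).
rewrite adjmxM trmxCK !mulmxA -(mulmxA _ (spectralmx A)).
rewrite -(mulmxA _ (spectralmx A *m A)) -D.
have -> : (delta_mx i 0 : 'cV[C]_n) ^t* = delta_mx 0 i.
  by rewrite trmx_delta map_delta_mx.
by rewrite -rowE -colE !mxE eqxx mulr1n.
Qed.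

Lemma psd_diag (C : numClosedFieldType) (n : nat) (U : 'M[C]_n) (d : 'rV[C]_n) :
  U \is unitarymx -> (forall i, 0 <= d 0 i) ->
  psdmx (invmx U *m diag_mx d *m U).
Proof.
move=> Uu d0; have dr : map_mx Num.conj d = d.
  by apply/rowP => i; rewrite mxE; apply/CrealP/ger0_real.
split; first by rewrite invmx_unitary // !adjmxM trmxCK tr_diag_mx map_diag_mx
  dr mulmxA.
move=> v; rewrite invmx_unitary // !mulmxA -adjmxM -mulmxA mul_mx_diag.
set w := U *m v; rewrite mxE sumr_ge0 // => i _; rewrite !mxE.
by rewrite mulrAC mulr_ge0 // mulrC mul_conjC_ge0.
Qed.

Lemma mxsqrt_psd (C : numClosedFieldType) (n : nat) (A : 'M[C]_n) :
  psdmx A -> psdmx (mxsqrt A).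
Proof.
move=> /psd_spectral[_ d0]; apply: psd_diag; first exact: spectral_unitarymx.
by move=> i; rewrite mxE sqrtC_ge0.
Qed.

Lemma mxsqrtK (C : numClosedFieldType) (n : nat) (A : 'M[C]_n) :
  psdmx A -> mxsqrt A *m mxsqrt A = A.
Proof.
move=> /psd_spectral[E _]; rewrite [RHS]E /mxsqrt !mulmxA.
rewrite mulmxK ?spectral_unit // -[X in X *m _ = _]mulmxA mulmx_diag.
congr (_ *m diag_mx _ *m _); apply/rowP => i.
by rewrite !mxE -expr2 sqrtCK.
Qed.

Lemma mxsqrt_uniq (C : numClosedFieldType) (n : nat) (A B : 'M[C]_n) :
  psdmx A -> psdmx B -> B *m B = A -> B = mxsqrt A.
Proof.
move=> /psd_spectral[EA a0] /psd_spectral[EB b0] BA.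
rewrite /mxsqrt; move: EA EB a0 b0.
have := spectral_unit A; have := spectral_unit B.
move: (spectralmx A) (spectral_diag A) (spectralmx B) (spectral_diag B).
move=> Q e P d Pu Qu EA EB e0 d0.
pose W := Q *m invmx P.
have WE : W *m diag_mx (\row_i (d 0 i ^+ 2)) = diag_mx e *m W.
  have -> : diag_mx e = Q *m A *m invmx Q.
    by rewrite EA !mulmxA mulmxV // mul1mx mulmxK.
  rewrite /W !mulmxA mulmxKV // -BA EB !mulmxA !mulmxK // -[RHS]mulmxA.
  rewrite mulmx_diag; congr (_ *m diag_mx _).
have WS : W *m diag_mx d = diag_mx (map_mx sqrtC e) *m W.
  apply/matrixP => i j; move/matrixP/(_ i j): WE.
  rewrite !mul_mx_diag !mul_diag_mx !mxE.
  have [->|w0] := eqVneq (\sum_j0 Q i j0 * invmx P j0 j) 0.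
    by rewrite !mul0r !mulr0.
  by rewrite mulrC => /(mulIf w0) <-; rewrite sqrCK // mulrC.
have -> : diag_mx (map_mx sqrtC e) = W *m diag_mx d *m P *m invmx Q.
  by rewrite WS /W !mulmxA mulmxKV // mulmxK.
by rewrite {1}EB /W !mulmxA mulVmx // mul1mx mulmxKV.
Qed.

Lemma psd_modulusL (R : realType) (n : nat) (X : 'M[R[i]]_n) :
  psdmx (X ^t* *m X).
Proof.
split; first by rewrite adjmxM trmxCK.
move=> v; rewrite mulmxA -adjmxM -mulmxA mxE sumr_ge0 // => i _.
by rewrite !mxE mulrC mul_conjC_ge0.
Qed.

Lemma psd_modulusC (R : realType) (n : nat) (X : 'M[R[i]]_n) :
  psdmx (2^-1 *: (X ^t* *m X + X *m X ^t*)).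
Proof.
have [h1 p1] := psd_modulusL X; have [h2 p2] := psd_modulusL (X ^t*).
rewrite trmxCK in h2 p2; split.
  by rewrite linearZ linearD /= map_mxZ map_mxD h1 h2 fmorphV rmorph_nat.
move=> v; rewrite -scalemxAr -scalemxAl mulmxDr mulmxDl mxE mulr_ge0 //.
  by rewrite invr_ge0.
by rewrite mxE addr_ge0.
Qed.

Lemma l2norm_ge0 (R : realType) (n : nat) (v : 'cV[R[i]]_n) : 0 <= l2norm v.
Proof. exact: sqrtr_ge0. Qed.

Lemma l2normE (R : realType) (n : nat) (v : 'cV[R[i]]_n) :
  (v ^t* *m v) 0 0 = (l2norm v ^+ 2)%:C.
Proof.
rewrite sqr_sqrtr; last by apply: sumr_ge0 => i _; apply: sqr_ge0.
rewrite mxE rmorph_sum; apply: eq_bigr => i _.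
by rewrite !mxE mulrC -normCK rmorphXn.
Qed.

Lemma l2normD (R : realType) (n : nat) (u v : 'cV[R[i]]_n) :
  l2norm (u + v) <= l2norm u + l2norm v.
Proof.
have dE (w : 'cV[R[i]]_n) : sqrtC (dotmx w^T w^T) = (l2norm w)%:C.
  rewrite dotmxE -[LHS](@sqrCK _ (sqrtC _)) ?sqrtC_ge0 ?sqrtCK; last first.
    by rewrite -dotmxE dnorm_ge0.
  have -> : (w^T *m (w^T) ^t*) 0 0 = (l2norm w ^+ 2)%:C.
    rewrite -l2normE !mxE; apply: eq_bigr => i _.
    by rewrite !mxE mulrC.
  by rewrite rmorphXn sqrCK // lecR l2norm_ge0.
have T : sqrtC (dotmx (u^T + v^T) (u^T + v^T)) <=
    sqrtC (dotmx u^T u^T) + sqrtC (dotmx v^T v^T).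
  by case: (triangle_lerif (@dotmx R[i] n) u^T v^T).
have D : u^T + v^T = (u + v)^T by rewrite linearD.
have key (x y z x' y' z' : R[i]) :
  x = x' -> y = y' -> z = z' -> x <= y + z -> x' <= y' + z' by move=> -> -> ->.
rewrite D in T; move: (key _ _ _ _ _ _ (dE (u + v)) (dE u) (dE v) T).
move: (l2norm (u + v)) (l2norm u) (l2norm v) => a b c.
by rewrite -(rmorphD (real_complex R)) lecR.
Qed.

Lemma l2normZ (R : realType) (n : nat) (a : R[i]) (v : 'cV[R[i]]_n) :
  l2norm (a *: v) = normc a * l2norm v.
Proof.
rewrite /l2norm -[normc a]ger0_norm ?normr_ge0; last first.
  exact: (@normr_ge0 _ (Rcomplex R)).
rewrite -sqrtr_sqr -sqrtrM ?sqr_ge0 // mulr_sumr.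
by congr Num.sqrt; apply: eq_bigr => i _; rewrite mxE normcM exprMn.
Qed.

Lemma l2norm0 (R : realType) (n : nat) : l2norm (0 : 'cV[R[i]]_n) = 0.
Proof. by rewrite -(scale0r 0) l2normZ normc0 mul0r. Qed.

Lemma normc_le_l2norm (R : realType) (n : nat) (v : 'cV[R[i]]_n) (i : 'I_n) :
  normc (v i 0) <= l2norm v.
Proof.
have n0 : 0 <= normc (v i 0) by exact: (@normr_ge0 _ (Rcomplex R)).
rewrite -[leLHS]ger0_norm // -sqrtr_sqr ler_wsqrtr // (bigD1 i) //=.
by rewrite lerDl sumr_ge0 // => j _; rewrite sqr_ge0.
Qed.

Lemma opnorm_has_sup (R : realType) (n : nat) (A : 'M[R[i]]_n) :
  has_sup [set l2norm (A *m v) | v in [set v : 'cV[R[i]]_n | l2norm v <= 1]].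
Proof.
split; first by exists (l2norm (A *m 0)), 0; rewrite //= l2norm0.
exists (Num.sqrt (\sum_i (\sum_j normc (A i j)) ^+ 2)) => _ [v /= v1 <-].
apply: ler_wsqrtr; apply: ler_sum => i _.
rewrite ler_pXn2r ?nnegrE //; last 2 first.
- exact: (@normr_ge0 _ (Rcomplex R)).
- by apply: sumr_ge0 => j _; exact: (@normr_ge0 _ (Rcomplex R)).
rewrite mxE; apply: (le_trans (@ler_norm_sum R (Rcomplex R) _ _ _ _)).
apply: ler_sum => j _; rewrite [leLHS]normcM ler_piMr //.
  exact: (@normr_ge0 _ (Rcomplex R)).
exact: le_trans (normc_le_l2norm _ _) v1.
Qed.

Lemma l2norm_le_opnorm (R : realType) (n : nat) (A : 'M[R[i]]_n)
  (v : 'cV[R[i]]_n) : l2norm v <= 1 -> l2norm (A *m v) <= opnorm A.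
Proof.
by move=> v1; apply: (ub_le_sup (proj2 (opnorm_has_sup A))); exists v.
Qed.

Lemma opnorm_le (R : realType) (n : nat) (A : 'M[R[i]]_n) (c : R) :
  (forall v, l2norm v <= 1 -> l2norm (A *m v) <= c) -> opnorm A <= c.
Proof.
move=> Ac; apply: ge_sup; first exact: (proj1 (opnorm_has_sup A)).
by move=> _ [v v1 <-]; exact: Ac.
Qed.

Lemma opnorm_ge0 (R : realType) (n : nat) (A : 'M[R[i]]_n) : 0 <= opnorm A.
Proof.
by apply: le_trans (l2norm_le_opnorm A (v := 0) _); rewrite ?mulmx0 l2norm0.
Qed.

Lemma l2norm_psdsqrt (R : realType) (n : nat) (A : 'M[R[i]]_n)
  (v : 'cV[R[i]]_n) : psdmx A ->
  (l2norm (mxsqrt A *m v) ^+ 2)%:C = (v ^t* *m A *m v) 0 0.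
Proof.
move=> Ap; have [h _] := mxsqrt_psd Ap.
by rewrite -l2normE adjmxM h mulmxA -[X in X *m v]mulmxA mxsqrtK.
Qed.

Lemma l2norm_modulusL (R : realType) (n : nat) (X : 'M[R[i]]_n)
  (v : 'cV[R[i]]_n) : l2norm (modulusL X *m v) = l2norm (X *m v).
Proof.
apply/eqP; rewrite -(@eqrXn2 _ 2) ?l2norm_ge0 //; apply/eqP.
apply: (@complexI R); rewrite l2norm_psdsqrt; last exact: psd_modulusL.
by rewrite -l2normE adjmxM !mulmxA.
Qed.

Lemma l2norm_modulusC (R : realType) (n : nat) (X : 'M[R[i]]_n)
  (v : 'cV[R[i]]_n) : l2norm (modulusC X *m v) ^+ 2 =
  2^-1 * (l2norm (X *m v) ^+ 2 + l2norm (X ^t* *m v) ^+ 2).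
Proof.
apply: (@complexI R); rewrite l2norm_psdsqrt; last exact: psd_modulusC.
transitivity (2^-1 *
  (((X *m v) ^t* *m (X *m v)) 0 0 + ((X ^t* *m v) ^t* *m (X ^t* *m v)) 0 0)).
  rewrite (adjmxM X) (adjmxM (X ^t*)) trmxCK.
  by rewrite -scalemxAr -scalemxAl mulmxDr mulmxDl !mulmxA !mxE.
have key (x y x' y' : R[i]) :
  x = x' -> y = y' -> 2^-1 * (x + y) = 2^-1 * (x' + y') by move=> -> ->.
have half (a b : R) : 2^-1 * (a%:C + b%:C) = (2^-1 * (a + b))%:C.
  by rewrite (rmorphM (real_complex R)) (rmorphD (real_complex R)) fmorphV
    rmorph_nat.
exact: etrans (key _ _ _ _ (l2normE (X *m v)) (l2normE (X ^t* *m v)))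
  (half _ _).
Qed.

Lemma lipschitz_coercive_min (R : realType) (N : R[i] -> R) (c : R) :
  (forall y z, N y <= N z + normc (y - z)) ->
  (forall y, normc y <= N y + c) ->
  exists y, forall z, N y <= N z.
Proof.
move=> NL Nc; pose g (p : R * R) := N (p.1 +i* p.2).
have normc_le (a b : R) : normc (a +i* b) <= `|a| + `|b|.
  have -> : a +i* b = a%:C + 0 +i* b by simpc.
  apply: le_trans (le_normcD _ _) _ => /=.
  by rewrite !expr0n /= addr0 add0r !sqrtr_sqr.
have gc : continuous g.
  move=> p; apply/(@cvgrPdist_le _ _) => e e0.
  near=> t.
  have h1 : `|p.1 - t.1| <= e / 2.
    near: t; apply: (@cvgr_dist_le _ _ _ _ _ (fun t : R * R => t.1) p.1).
      exact: cvg_fst.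
    by rewrite divr_gt0.
  have h2 : `|p.2 - t.2| <= e / 2.
    near: t; apply: (@cvgr_dist_le _ _ _ _ _ (fun t : R * R => t.2) p.2).
      exact: cvg_snd.
    by rewrite divr_gt0.
  have D : normc ((p.1 +i* p.2) - (t.1 +i* t.2)) <= e.
    apply: le_trans (normc_le _ _) _.
    by rewrite [e]splitr lerD.
  rewrite ler_distl; apply/andP; split.
    rewrite lerBlDr; apply: le_trans (NL _ (p.1 +i* p.2)) _.
    by rewrite lerD2l -normcN opprB.
  by apply: le_trans (NL _ (t.1 +i* t.2)) _; rewrite lerD2l.
pose M := N 0 + c.
have M0 : 0 <= M by apply: le_trans (Nc 0); rewrite normc0.
have cA : compact (`[- M, M]%classic `*` `[- M, M]%classic : set (R * R)).
  by apply: compact_setX; exact: segment_compact.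
have M0I : `[- M, M]%classic 0 by rewrite /= in_itv /= oppr_le0 M0.
have [|p _ pmin] := compact_EVT_min _ cA (continuous_subspaceT gc).
  by exists (0, 0).
exists (p.1 +i* p.2) => -[a b].
have [inA|outA] := pselect (`[- M, M]%classic a /\ `[- M, M]%classic b).
  by apply: (pmin (a, b)); rewrite inE.
have : M < normc (a +i* b).
  rewrite ltNge; apply/negP => h; apply: outA.
  rewrite /= !in_itv /= -!ler_norml.
  split; apply: le_trans h => /=; rewrite -sqrtr_sqr ler_wsqrtr //.
    by rewrite lerDl sqr_ge0.
  by rewrite lerDr sqr_ge0.
move=> h; apply: (@le_trans _ _ (N 0)).
  by apply: (pmin (0, 0)); rewrite inE.
by rewrite -(lerD2r c) ltW // (lt_le_trans h).
Unshelve. all: by end_near. Qed.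

Lemma inf_opnorm_min (R : realType) (n : nat) (F : R[i] -> 'M[R[i]]_n)
  (q : R[i] -> 'cV[R[i]]_n -> R) :
  (forall y v, l2norm (F y *m v) = q y v) ->
  (forall y z v, q y v <= q z v + normc (y - z) * l2norm v) ->
  (forall y v, normc y * l2norm v <= q y v + q 0 v) ->
  exists2 y, inf (range (fun y => opnorm (F y))) = opnorm (F y) &
    forall z, inf (range (fun y => opnorm (F y))) <= opnorm (F z).
Proof.
move=> Fq FL Fc; set r := inf _.
have normc_ge0 (x : R[i]) : 0 <= normc x by exact: (@normr_ge0 _ (Rcomplex R)).
suff [y yP] : exists y, forall z, opnorm (F y) <= opnorm (F z).
  have rE : r = opnorm (F y).
    apply/eqP; rewrite eq_le; apply/andP; split.
      by apply: ge_inf; [exists (opnorm (F y)) => _ [z _ <-]|exists y].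
    by apply: lb_le_inf; [exists (opnorm (F y)), y|move=> _ [z _ <-]].
  by exists y => // z; rewrite rE.
case: n F q Fq FL Fc @r => [|n] F q Fq FL Fc _.
  by exists 0 => z; rewrite (thinmx0 (F 0)) (thinmx0 (F z)).
apply: (@lipschitz_coercive_min _ _ (opnorm (F 0))) => y.
  move=> z; apply: opnorm_le => v v1; rewrite Fq; apply: le_trans (FL _ z _) _.
  by rewrite -Fq lerD ?l2norm_le_opnorm // ler_piMr.
pose v : 'cV[R[i]]_n.+1 := delta_mx 0 0.
have v1 : l2norm v = 1.
  rewrite /l2norm (bigD1 0) //= mxE !eqxx normc1 big1 ?addr0 ?expr1n ?sqrtr1 //.
  by move=> j /negPf j0; rewrite mxE j0 normc0 expr0n.
have := Fc y v; rewrite v1 mulr1 => /le_trans; apply.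
by rewrite -!Fq lerD ?l2norm_le_opnorm ?v1.
Qed.

Lemma subr_0mx (R : nzRingType) (n : nat) (X : 'M[R]_n) : X - 0%:M = X.
Proof. by apply/matrixP => i j; rewrite !mxE mul0rn subr0. Qed.

Lemma radiusL_min (R : realType) (n : nat) (X : 'M[R[i]]_n) :
  exists2 y, radiusL X = opnorm (modulusL (X - y%:M)) &
    forall z, radiusL X <= opnorm (modulusL (X - z%:M)).
Proof.
apply: (inf_opnorm_min (fun y => l2norm_modulusL (X - y%:M))) => [y z v|y v].
  have -> : (X - y%:M) *m v = (X - z%:M) *m v + (z - y) *: v.
    by rewrite !mulmxBl !mul_scalar_mx scalerBl addrA subrK.
  by apply: le_trans (l2normD _ _) _; rewrite l2normZ -normcN opprB.
rewrite (subr_0mx X).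
rewrite -(l2normZ y v) addrC.
have -> : y *: v = X *m v + (-1) *: ((X - y%:M) *m v).
  by rewrite mulmxBl mul_scalar_mx scaleN1r opprB addrC subrK.
by apply: le_trans (l2normD _ _) _; rewrite l2normZ normcN normc1 mul1r.
Qed.

Lemma l2norm_sq (R : realType) (n : nat) (v : 'cV[R[i]]_n) :
  l2norm v ^+ 2 = \sum_(i < n) normc (v i 0) ^+ 2.
Proof. by rewrite sqr_sqrtr //; apply: sumr_ge0 => i _; apply: sqr_ge0. Qed.

Lemma l2norm_col_mx (R : realType) (m n : nat) (u : 'cV[R[i]]_m)
  (v : 'cV[R[i]]_n) : l2norm (col_mx u v) ^+ 2 = l2norm u ^+ 2 + l2norm v ^+ 2.
Proof.
rewrite !l2norm_sq big_split_ord /=; congr (_ + _); apply: eq_bigr => i _.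
  by rewrite col_mxEu.
by rewrite col_mxEd.
Qed.

Lemma l2norm_modulusC_col (R : realType) (n : nat) (X : 'M[R[i]]_n)
  (v : 'cV[R[i]]_n) : l2norm (modulusC X *m v) =
  (Num.sqrt 2)^-1 * l2norm (col_mx (X *m v) (X ^t* *m v)).
Proof.
apply/eqP; rewrite -(@eqrXn2 _ 2) ?mulr_ge0 ?invr_ge0 ?sqrtr_ge0 //.
rewrite l2norm_modulusC exprMn exprVn (sqr_sqrtr (ler0n _ 2)).
by rewrite l2norm_col_mx.
Qed.

Lemma l2norm_col_conj (R : realType) (n : nat) (y : R[i]) (v : 'cV[R[i]]_n) :
  l2norm (col_mx (y *: v) (y^* *: v)) = Num.sqrt 2 * (normc y * l2norm v).
Proof.
rewrite -l2normZ /l2norm -sqrtrM // big_split_ord /= mulr_natl mulr2n.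
congr (Num.sqrt (_ + _)); apply: eq_bigr => i _.
  by rewrite col_mxEu.
rewrite col_mxEd !mxE !normcM; congr ((_ * _) ^+ 2).
by case: y => a b /=; rewrite sqrrN.
Qed.

Lemma radiusC_min (R : realType) (n : nat) (X : 'M[R[i]]_n) :
  exists2 y, radiusC X = opnorm (modulusC (X - y%:M)) &
    forall z, radiusC X <= opnorm (modulusC (X - z%:M)).
Proof.
have s2 : 0 < Num.sqrt 2 :> R by rewrite sqrtr_gt0.
have adjB (y : R[i]) : (X - y%:M) ^t* = X ^t* - (y^*)%:M.
  by rewrite linearB /= tr_scalar_mx map_mxB map_scalar_mx.
apply: (inf_opnorm_min (fun y => l2norm_modulusC_col (X - y%:M)))
  => [y z v|y v].
  have -> : col_mx ((X - y%:M) *m v) ((X - y%:M) ^t* *m v) =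
    col_mx ((X - z%:M) *m v) ((X - z%:M) ^t* *m v)
    + col_mx ((z - y) *: v) ((z - y)^* *: v).
    rewrite add_col_mx !adjB rmorphB !mulmxBl !mul_scalar_mx !scalerBl.
    by congr col_mx; rewrite [RHS]addrA subrK.
  rewrite ler_pdivrMl // mulrDr mulVKf ?gt_eqF //.
  by apply: le_trans (l2normD _ _) _; rewrite l2norm_col_conj -normcN opprB.
rewrite (subr_0mx X).
rewrite -mulrDr ler_pdivlMl // -(l2norm_col_conj y v) addrC.
have -> : col_mx (y *: v) (y^* *: v) = col_mx (X *m v) (X ^t* *m v)
    + (-1) *: col_mx ((X - y%:M) *m v) ((X - y%:M) ^t* *m v).
  rewrite scale_col_mx add_col_mx (adjB y) !mulmxBl !mul_scalar_mx.
  by congr col_mx; rewrite scaleN1r opprB [RHS]addrC subrK.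
by apply: le_trans (l2normD _ _) _; rewrite l2normZ normcN normc1 mul1r.
Qed.

Lemma singular_values_sorted (R : realType) (n : nat) (X : 'M[R[i]]_n) :
  sorted >=%R (singular_values X) /\ size (singular_values X) = n.
Proof.
split; first by apply: sort_sorted => x y; exact: le_total.
by rewrite size_sort size_map size_enum_ord.
Qed.

Lemma char_poly_singular_values (R : realType) (n : nat) (X : 'M[R[i]]_n) :
  char_poly (X ^t* *m X) =
  \prod_(s <- singular_values X) ('X - ((s ^+ 2)%:C)%:P).
Proof.
have [E d0] := psd_spectral (psd_modulusL X).
rewrite (perm_big _ (permEl (perm_sort _ _))) big_image /=.
have Ui := spectral_unit (X ^t* *m X).
set U := spectralmx _ in E Ui; set d := spectral_diag _ in E d0 *.
have -> : char_poly (X ^t* *m X) = char_poly (diag_mx d).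
  rewrite E /char_poly -[RHS]mul1r -(det1 _ n) -(map_mx1 polyC) -(mulVmx Ui).
  rewrite map_mxM det_mulmx mulrAC -!det_mulmx; congr (\det _).
  rewrite /char_poly_mx !map_mxM mulmxBr mulmxBl; congr (_ - _).
  by rewrite mul_mx_scalar -scalemxAl -map_mxM mulVmx // map_mx1 scalemx1.
rewrite char_poly_trig ?diag_mx_is_trig //; apply: eq_bigr => i _.
rewrite mxE eqxx mulr1n.
have := d0 i; rewrite lecE /= => /andP[/eqP i0 r0].
rewrite sqr_sqrtr //; congr ('X - _%:P); apply/eqP.
by rewrite eq_complex /= i0 !eqxx.
Qed.

(* Main.v *)
Require Import Defs.
From mathcomp Require Import all_boot all_order all_algebra.
From mathcomp Require Import complex reals.
From mathcomp Require Import perm.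
From mathcomp Require Import boolp classical_sets.
From mathcomp Require Import topology normedtype derive.
From mathcomp Require Import ring lra.
Set Implicit Arguments.
Unset Strict Implicit.
Unset Printing Implicit Defensive.
Import Order.TTheory GRing.Theory Num.Theory.
Import numFieldNormedType.Exports.
Import ComplexField.Normc.
Local Open Scope ring_scope.
Local Open Scope complex_scope.
Local Open Scope sesquilinear_scope.
Local Open Scope classical_set_scope.

(** The bound on [radiusL] is the value at the centre 0: [|X|_L] and [X] have
    the same operator norm. That this norm is the largest singular value is
    read off from the spectral theorem for [X^* X].

    For [radiusC] the centre 0 does not suffice, and the argument runs through
    an optimality condition. Let [y] be an optimal centre, put [Y = X - y],
    [G = |Y|_C] and [K v = v^* Y v]. The claim is that some unit vector [v]
    attains the norm of [G] and satisfies [K v = 0] ([optimal_vector]).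

    Since [|G_t v|^2 = |G v|^2 - 2 Re (t^* K v) + |t|^2 |v|^2] for
    [G_t = |Y - t|_C], a direction [z] with [Re (z^* K p) > 0] for all unit
    vectors [p] attaining the norm of [G] would be one in which moving the
    centre lowers the norm. So for every [z] some such [p] satisfies
    [Re (z^* K p) <= 0] ([optimal_direction]); in other words 0 is in the
    convex hull of the values of [K] at these vectors. The vectors attaining
    the norm form a linear subspace, on which the values of [K] at unit vectors
    form a convex set by the Toeplitz-Hausdorff theorem, whence the claim. Only
    a local form of that theorem is needed: if [v] minimizes [|K v|] there and
    [z = K v] is not 0, then moving [v] towards the [p] belonging to [z], with
    a suitable phase, decreases [|K|] ([aligned_phase] and
    [second_order_escape]).

    For this [v], the square of the radius is the mean of [|Y v|^2] and
    [|Y^* v|^2], where [Y v] and [Y^* v] are orthogonal to [v]. If [e] is the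
    unit vector along [Y^* v], then [|Y v| <= |X v|], while [X e] has component
    [|Y^* v|] along [v]; hence [|Y v|^2 + |Y^* v|^2 <= |X v|^2 + |X e|^2], and
    Ky Fan's maximum principle for the orthonormal pair [v], [e] bounds the
    right-hand side by [sigma_1^2 + sigma_2^2] ([centred_l2norm_le_sigma]). *)

(** * The Hermitian inner product *)
Definition hdot (R : realType) (n : nat) (u v : 'cV[R[i]]_n) : R[i] :=
  (u ^t* *m v) 0 0.

Lemma normc_ge0 (R : realType) (x : R[i]) : 0 <= normc x.
Proof. exact: (@normr_ge0 _ (Rcomplex R)). Qed.

Section Hdot.
Variables (R : realType) (n : nat).
Implicit Types (u v w : 'cV[R[i]]_n) (a : R[i]) (A : 'M[R[i]]_n).

Lemma hdotE u v : hdot u v = \sum_i (u i 0)^* * v i 0.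
Proof. by rewrite /hdot mxE; apply: eq_bigr => i _; rewrite !mxE. Qed.

Lemma hdotDl u v w : hdot (u + v) w = hdot u w + hdot v w.
Proof. by rewrite /hdot linearD /= map_mxD mulmxDl mxE. Qed.

Lemma hdotDr u v w : hdot u (v + w) = hdot u v + hdot u w.
Proof. by rewrite /hdot mulmxDr mxE. Qed.

Lemma hdotZl a u v : hdot (a *: u) v = a^* * hdot u v.
Proof. by rewrite /hdot linearZ /= map_mxZ -scalemxAl mxE. Qed.

Lemma hdotZr a u v : hdot u (a *: v) = a * hdot u v.
Proof. by rewrite /hdot -scalemxAr mxE. Qed.

Lemma hdotC u v : hdot v u = (hdot u v)^*.
Proof.
rewrite !hdotE rmorph_sum; apply: eq_bigr => i _.
by rewrite rmorphM /= conjcK mulrC.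
Qed.

Lemma hdot_adj A u v : hdot (A *m u) v = hdot u (A ^t* *m v).
Proof. by rewrite /hdot adjmxM mulmxA. Qed.

Lemma hdotvv v : hdot v v = (l2norm v ^+ 2)%:C.
Proof. exact: l2normE. Qed.

Lemma ReD (x y : R[i]) : complex.Re (x + y) = complex.Re x + complex.Re y.
Proof. by case: x y => [a b] []. Qed.

Lemma ImD (x y : R[i]) : complex.Im (x + y) = complex.Im x + complex.Im y.
Proof. by case: x y => [a b] []. Qed.

Lemma Re_realM (c : R) (x : R[i]) : complex.Re (c%:C * x) = c * complex.Re x.
Proof. by case: x => a b /=; rewrite mul0r subr0. Qed.

Lemma Re_conj (x : R[i]) : complex.Re x^* = complex.Re x.
Proof. by case: x. Qed.

Lemma l2norm_sqE v : l2norm v ^+ 2 = complex.Re (hdot v v).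
Proof. by rewrite hdotvv. Qed.

Lemma l2norm_sqD u v :
  l2norm (u + v) ^+ 2 =
  l2norm u ^+ 2 + l2norm v ^+ 2 + 2 * complex.Re (hdot u v).
Proof.
rewrite !l2norm_sqE hdotDl !hdotDr (hdotC u v) !ReD Re_conj; ring.
Qed.

Lemma l2norm_sqZ a v : l2norm (a *: v) ^+ 2 = normc a ^+ 2 * l2norm v ^+ 2.
Proof. by rewrite l2normZ exprMn. Qed.

Lemma normc_sq (a : R[i]) :
  normc a ^+ 2 = complex.Re a ^+ 2 + complex.Im a ^+ 2.
Proof. by case: a => x y /=; rewrite sqr_sqrtr // addr_ge0 ?sqr_ge0. Qed.

Lemma l2norm_realZ (c : R) v : 0 <= c -> l2norm (c%:C *: v) = c * l2norm v.
Proof.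
by move=> c0; rewrite l2normZ /= expr0n /= addr0 sqrtr_sqr ger0_norm.
Qed.

Lemma l2norm_delta (i : 'I_n) : l2norm (delta_mx i 0 : 'cV[R[i]]_n) = 1.
Proof.
rewrite /l2norm (bigD1 i) //= mxE !eqxx normc1 big1 ?addr0 ?expr1n ?sqrtr1 //.
by move=> j /negPf j0; rewrite mxE j0 normc0 expr0n.
Qed.

Lemma l2norm_eq0 v : l2norm v = 0 -> v = 0.
Proof.
move=> v0; apply/matrixP => i j; rewrite ord1 mxE; apply: eq0_normc.
apply/eqP; rewrite eq_le (_ : 0 = l2norm v) // normc_le_l2norm v0.
exact: normc_ge0.
Qed.

(** The component of [v] orthogonal to [u] has nonnegative squared norm. *)
Lemma cauchy_schwarz_unit u v : l2norm u = 1 ->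
  normc (hdot u v) ^+ 2 <= l2norm v ^+ 2.
Proof.
move=> u1; have := sqr_ge0 (l2norm (v - hdot u v *: u)).
rewrite -scaleNr l2norm_sqD l2norm_sqZ u1 hdotZr (hdotC u v) !normc_sq.
by case: (hdot u v) => x y /=; nra.
Qed.

End Hdot.

(** * Minimization over the unit sphere *)

Section Compactness.
Variables (R : realType) (n : nat).
Local Notation T := ('rV[R]_n * 'rV[R]_n)%type.

(** A complex column is presented by its real and imaginary parts, so that
    compactness of real segments gives compactness of the unit sphere and
    polynomial expressions in these parts are continuous. *)
Definition real_pair_col (p : T) : 'cV[R[i]]_n := \col_i (p.1 0 i +i* p.2 0 i).

Definition cV_continuous (g : 'cV[R[i]]_n -> R) :=
  continuous (g \o real_pair_col).

Lemma cV_continuous_add f g : cV_continuous f -> cV_continuous g ->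
  cV_continuous (fun v => f v + g v).
Proof. by move=> fc gc p; apply: cvgD; [exact: fc|exact: gc]. Qed.

Lemma cV_continuous_cst c : cV_continuous (fun=> c).
Proof. by move=> p; exact: cvg_cst. Qed.

Lemma cV_continuous_mul f g : cV_continuous f -> cV_continuous g ->
  cV_continuous (fun v => f v * g v).
Proof. by move=> fc gc p; apply: cvgM; [exact: fc|exact: gc]. Qed.

Lemma cV_continuous_sub f g : cV_continuous f -> cV_continuous g ->
  cV_continuous (fun v => f v - g v).
Proof. by move=> fc gc p; apply: cvgB; [exact: fc|exact: gc]. Qed.

Lemma cV_continuous_max f g : cV_continuous f -> cV_continuous g ->
  cV_continuous (fun v => Num.max (f v) (g v)).
Proof.
move=> fc gc p.
exact: (@continuous_max _ _ (f \o real_pair_col) (g \o real_pair_col) p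
  (fc p) (gc p)).
Qed.

Lemma cV_continuous_sum (I : finType) (f : I -> 'cV[R[i]]_n -> R) :
  (forall i, cV_continuous (f i)) -> cV_continuous (fun v => \sum_i f i v).
Proof.
move=> fc; rewrite /cV_continuous.
elim: (index_enum I) => [|i s IH].
  under eq_fun do rewrite big_nil. exact: cV_continuous_cst.
under eq_fun do rewrite big_cons. exact: cV_continuous_add.
Qed.

Definition cV_continuousC (g : 'cV[R[i]]_n -> R[i]) :=
  cV_continuous (fun v => complex.Re (g v)) /\
  cV_continuous (fun v => complex.Im (g v)).

Lemma cV_continuousC_ext f g : f =1 g -> cV_continuousC f -> cV_continuousC g.
Proof. by move/funext=> ->. Qed.

Lemma cV_continuousC_cst c : cV_continuousC (fun=> c).
Proof. by split; exact: cV_continuous_cst. Qed.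

Lemma cV_continuousC_coord i : cV_continuousC (fun v => v i 0).
Proof.
split=> p.
  have -> : (fun v : 'cV[R[i]]_n => complex.Re (v i 0)) \o real_pair_col
      = fun p => p.1 0 i.
    by apply/funext => q /=; rewrite mxE.
  by apply: (@continuous_comp _ _ _ fst (fun a : 'rV[R]_n => a 0 i));
    [exact: cvg_fst|exact: coord_continuous].
have -> : (fun v : 'cV[R[i]]_n => complex.Im (v i 0)) \o real_pair_col
    = fun p => p.2 0 i.
  by apply/funext => q /=; rewrite mxE.
by apply: (@continuous_comp _ _ _ snd (fun a : 'rV[R]_n => a 0 i));
  [exact: cvg_snd|exact: coord_continuous].
Qed.

Lemma cV_continuousC_mul f g : cV_continuousC f -> cV_continuousC g ->
  cV_continuousC (fun v => f v * g v).
Proof.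
move=> [f1 f2] [g1 g2]; split.
  have -> : (fun v => complex.Re (f v * g v)) = (fun v =>
     complex.Re (f v) * complex.Re (g v) - complex.Im (f v) * complex.Im (g v)).
    by apply/funext => v; case: (f v) (g v) => [a b] [].
  by apply: cV_continuous_sub; exact: cV_continuous_mul.
have -> : (fun v => complex.Im (f v * g v)) = (fun v =>
   complex.Re (f v) * complex.Im (g v) + complex.Im (f v) * complex.Re (g v)).
  by apply/funext => v; case: (f v) (g v) => [a b] [].
by apply: cV_continuous_add; exact: cV_continuous_mul.
Qed.

Lemma cV_continuousC_conj f :
  cV_continuousC f -> cV_continuousC (fun v => (f v)^*).
Proof.
move=> [f1 f2]; split.
  by under eq_fun do rewrite Re_conj.
have -> : (fun v => complex.Im (f v)^*) = (fun v => 0 - complex.Im (f v)).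
  by apply/funext => v; case: (f v) => a b /=; rewrite sub0r.
by apply: cV_continuous_sub => //; exact: cV_continuous_cst.
Qed.

Lemma cV_continuousC_sum (I : finType) (f : I -> 'cV[R[i]]_n -> R[i]) :
  (forall i, cV_continuousC (f i)) -> cV_continuousC (fun v => \sum_i f i v).
Proof.
move=> fc; split.
  have -> : (fun v => complex.Re (\sum_i f i v)) =
      fun v => \sum_i complex.Re (f i v).
    apply/funext => v; elim/big_rec2: _ => // i x y _ <-; exact: ReD.
  by apply: cV_continuous_sum => i; case: (fc i).
have -> : (fun v => complex.Im (\sum_i f i v)) =
    fun v => \sum_i complex.Im (f i v).
  apply/funext => v; elim/big_rec2: _ => // i x y _ <-; exact: ImD.
by apply: cV_continuous_sum => i; case: (fc i).
Qed.

Lemma cV_continuousC_hdot (A B : 'M[R[i]]_n) :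
  cV_continuousC (fun v => hdot (A *m v) (B *m v)).
Proof.
have lin (M : 'M[R[i]]_n) i : cV_continuousC (fun v => (M *m v) i 0).
  apply: (@cV_continuousC_ext (fun v => \sum_j M i j * v j 0)).
    by move=> v; rewrite mxE.
  apply: cV_continuousC_sum => j; apply: cV_continuousC_mul.
    exact: cV_continuousC_cst.
  exact: cV_continuousC_coord.
apply: (@cV_continuousC_ext (fun v => \sum_i ((A *m v) i 0)^* * (B *m v) i 0)).
  by move=> v; rewrite hdotE.
apply: cV_continuousC_sum => i; apply: cV_continuousC_mul => //.
exact: cV_continuousC_conj.
Qed.

Lemma cV_continuous_l2norm_sq (A : 'M[R[i]]_n) :
  cV_continuous (fun v => l2norm (A *m v) ^+ 2).
Proof.
under eq_fun do rewrite l2norm_sqE.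
by case: (cV_continuousC_hdot A A).
Qed.

Lemma real_pair_col_surj v : exists p, real_pair_col p = v.
Proof.
exists (\row_i complex.Re (v i 0), \row_i complex.Im (v i 0)).
by apply/matrixP => i j; rewrite ord1 !mxE /=; case: (v i 0).
Qed.

(** The unit sphere is closed in the box of coordinates of absolute value at
    most 1, which is compact; the constraint [h <= 0] cuts out a closed part. *)
Lemma sphere_min_exists (g h : 'cV[R[i]]_n -> R) :
  cV_continuous g -> cV_continuous h ->
  (exists2 v, l2norm v = 1 & h v <= 0) ->
  exists v, [/\ l2norm v = 1, h v <= 0 &
    forall w, l2norm w = 1 -> h w <= 0 -> g v <= g w].
Proof.
move=> gc hc [v0 v01 hv0].
pose box := [set a : 'rV[R]_n | forall i, `[- 1, 1]%classic (a ord0 i)].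
have boxc : compact box.
  apply: (@rV_compact R n (fun=> `[- 1, 1]%classic)) => i.
  exact: segment_compact.
pose A := (box `*` box) `&`
  ([set p | l2norm (real_pair_col p) ^+ 2 = 1] `&`
   [set p | h (real_pair_col p) <= 0]).
have Ac : compact A.
  apply: compact_closedI; first exact: compact_setX.
  apply: closedI.
    apply: (@preimage_closed _ _ (fun p => l2norm (real_pair_col p) ^+ 2)
      [set x : R | x = 1]).
      move=> p _; have := @cV_continuous_l2norm_sq 1%:M p.
      by rewrite /comp; under eq_fun do rewrite mul1mx.
    exact: closed_eq.
  apply: (@preimage_closed _ _ (h \o real_pair_col) [set x : R | x <= 0]).
    by move=> p _; exact: hc.
  exact: closed_le.
have l1 v : l2norm v = 1 -> h v <= 0 -> exists2 p, A p & real_pair_col p = v.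
  move=> v1 hv; have [p pv] := real_pair_col_surj v; exists p => //.
  split; last by rewrite /= pv v1 expr1n.
  have nv i : normc (v i 0) ^+ 2 <= 1.
    rewrite -[1](expr1n _ 2) ler_pXn2r ?nnegrE //.
    - by rewrite -v1 normc_le_l2norm.
    - exact: normc_ge0.
  split=> i; rewrite /= in_itv /= -ler_norml -(@ler_pXn2r _ 2) ?nnegrE //.
    rewrite real_normK ?num_real // expr1n (le_trans _ (nv i)) //.
    by rewrite normc_sq -pv mxE /= lerDl sqr_ge0.
  rewrite real_normK ?num_real // expr1n (le_trans _ (nv i)) //.
  by rewrite normc_sq -pv mxE /= lerDr sqr_ge0.
have [p0 Ap0 _] := l1 _ v01 hv0.
have [|p pA pmin] := compact_EVT_min _ Ac (continuous_subspaceT gc).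
  by exists p0.
move: pA; rewrite inE => -[_ [/= p1 hp]].
exists (real_pair_col p); split=> //.
  by apply/eqP; rewrite -(@eqrXn2 _ 2) ?l2norm_ge0 // p1 expr1n.
move=> w w1 hw; have [q Aq <-] := l1 _ w1 hw.
by apply: pmin; rewrite inE.
Qed.

End Compactness.

(** * Singular values *)

(** The index [i0] is the place of one occurrence of the maximum; removing that
    occurrence leaves the second entry of the sorted list as a bound. For a
    single value the last clause is vacuous. *)
Lemma sort_top2 (R : realType) (n : nat) (f : 'I_n.+1 -> R) :
  let s := sort >=%R [seq f i | i : 'I_n.+1] in
  exists i0, [/\ f i0 = nth 0 s 0, forall i, f i <= nth 0 s 0 &
    forall i, i != i0 -> f i <= nth 0 s 1].
Proof.
move=> s.
have ss : sorted >=%R s by apply: sort_sorted => x y; exact: le_total.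
have sz : size s = n.+1 by rewrite size_sort size_map size_enum_ord.
have szP : size s == n.+1 by rewrite sz.
have szQ : size [seq f i | i : 'I_n.+1] == n.+1.
  by rewrite size_map size_enum_ord.
have : perm_eq (Tuple szQ) (Tuple szP) by rewrite perm_sym /= perm_sort.
case/tuple_permP => p fp.
have fE i : f i = nth 0 s (p i).
  have -> : f i = nth 0 [seq f i | i : 'I_n.+1] i.
    by rewrite (nth_map i) ?size_enum_ord // nth_ord_enum.
  rewrite -[X in nth _ X](_ : tval (Tuple szQ) = _) // fp /=.
  by rewrite (nth_map i) ?size_enum_ord // nth_ord_enum (tnth_nth 0).
have sle j k : (j <= k)%N -> (k < n.+1)%N -> nth 0 s k <= nth 0 s j.
  move=> jk kn; apply: (sorted_leq_nth ge_trans lexx 0 ss) => //.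
  - by rewrite inE sz (leq_ltn_trans jk).
  - by rewrite inE sz.
exists ((p^-1)%g ord0); split.
- by rewrite fE permKV.
- by move=> i; rewrite fE sle.
move=> i ii0; rewrite fE sle // lt0n; apply: contra ii0 => /eqP pi0.
by apply/eqP; apply: (@perm_inj _ p); rewrite permKV; apply: val_inj.
Qed.

(** Diagonalizing [X^* X] writes [|X v|^2] as a weighted sum of the squared
    coordinates of [v] in an orthonormal basis, the weights being the squares
    of the singular values. *)
Lemma singular_decomposition (R : realType) (n : nat) (X : 'M[R[i]]_n.+1) :
  exists U : 'M[R[i]]_n.+1, exists f : 'I_n.+1 -> R, exists i0,
  [/\ U ^t* *m U = 1%:M /\ U *m U ^t* = 1%:M,
      forall v, l2norm (X *m v) ^+ 2 =
        \sum_i f i ^+ 2 * normc ((U *m v) i 0) ^+ 2,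
      f i0 = sigma X 1,
      forall i, 0 <= f i <= sigma X 1 &
      forall i, i != i0 -> f i <= sigma X 2].
Proof.
have [E d0] := psd_spectral (psd_modulusL X).
pose U := spectralmx (X ^t* *m X); pose d := spectral_diag (X ^t* *m X).
have Uu : U \is unitarymx := spectral_unitarymx _.
have Ui : U \in unitmx := spectral_unit _.
pose f i := Num.sqrt (complex.Re (d 0 i)).
have [i0 [f0 f1 f2]] := sort_top2 f.
exists U, f, i0; split=> //.
- by rewrite -invmx_unitary // mulVmx ?mulmxV.
- move=> v; rewrite l2norm_sqE hdot_adj mulmxA E -/U -/d invmx_unitary //.
  rewrite -!mulmxA -{1}[U]trmxCK -hdot_adj trmxCK hdotE.
  transitivity (complex.Re (\sum_i (f i ^+ 2 * normc ((U *m v) i 0) ^+ 2)%:C)).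
    congr complex.Re; apply: eq_bigr => i _.
    rewrite mul_diag_mx !mxE mulrCA.
    have := d0 i; rewrite -/d lecE /= => /andP[/eqP i0' r0].
    rewrite sqr_sqrtr // normc_sq.
    case: (d 0 i) i0' r0 => a b /= -> _.
    by case: (\sum_j _) => x y; apply/eqP;
      rewrite eq_complex /=; apply/andP; split; apply/eqP; ring.
  by elim/big_rec2: _ => // i x y _ <-; rewrite ReD.
- by move=> i; rewrite sqrtr_ge0 /=; exact: f1.
Qed.

Lemma unitary_hdot (R : realType) (n : nat) (U : 'M[R[i]]_n) u v :
  U ^t* *m U = 1%:M -> hdot (U *m u) (U *m v) = hdot u v.
Proof. by move=> UU; rewrite hdot_adj mulmxA UU mul1mx. Qed.

Lemma unitary_l2norm (R : realType) (n : nat) (U : 'M[R[i]]_n) v :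
  U ^t* *m U = 1%:M -> l2norm (U *m v) = l2norm v.
Proof.
move=> UU; apply/eqP; rewrite -(@eqrXn2 _ 2) ?l2norm_ge0 //.
by rewrite !l2norm_sqE unitary_hdot.
Qed.

(** Bessel's inequality for the [i]-th basis vector: [w] is its projection on
    the span of [u] and [v], so that [t = |w|^2] is also the [i]-th coordinate
    of [w], whence [t^2 <= t]. *)
Lemma bessel_coord (R : realType) (n : nat) (u v : 'cV[R[i]]_n) i :
  l2norm u = 1 -> l2norm v = 1 -> hdot u v = 0 ->
  normc (u i 0) ^+ 2 + normc (v i 0) ^+ 2 <= 1.
Proof.
move=> u1 v1 uv; set t := _ + _.
pose w := (u i 0)^* *: u + (v i 0)^* *: v.
have nconj (x : R[i]) : normc x^* ^+ 2 = normc x ^+ 2.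
  by rewrite !normc_sq; case: x => a b /=; rewrite sqrrN.
have wt : l2norm w ^+ 2 = t.
  rewrite l2norm_sqD !l2norm_sqZ u1 v1 hdotZl hdotZr uv !mulr0 !nconj.
  by rewrite addr0 expr1n !mulr1.
have wi : normc (w i 0) ^+ 2 = t ^+ 2.
  rewrite normc_sq !mxE /t !normc_sq.
  by case: (u i 0) (v i 0) => a b [c d] /=; ring.
have : t ^+ 2 <= t.
  rewrite -wi -[leRHS]wt ler_pXn2r ?nnegrE ?normc_ge0 ?l2norm_ge0 //.
  exact: normc_le_l2norm.
have : 0 <= t by rewrite addr_ge0 ?sqr_ge0.
nra.
Qed.

Lemma sigma2_le (R : realType) (n : nat) (X : 'M[R[i]]_n) :
  0 <= sigma X 2 <= sigma X 1.
Proof.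
rewrite /sigma /=; set s := singular_values X.
have s0 k : 0 <= nth 0 s k.
  have [ks|sk] := ltnP k (size s); last by rewrite nth_default.
  by have := mem_nth 0 ks; rewrite mem_sort => /mapP[i _ ->]; exact: sqrtr_ge0.
rewrite s0 /=; have [s1|s1] := ltnP 1 (size s); last by rewrite nth_default.
have [ss _] := singular_values_sorted X.
apply: (sorted_leq_nth ge_trans lexx 0 ss) => //.
by rewrite inE (ltn_trans _ s1).
Qed.

(** Ky Fan's maximum principle for two vectors. In the singular basis the left
    side is the sum of the [f i ^+ 2] with weights [w i] between 0 and 1 that
    add up to 2; it is largest when the weight sits on the two largest
    values. *)
Lemma ky_fan2 (R : realType) (n : nat) (X : 'M[R[i]]_n.+1) u v :
  l2norm u = 1 -> l2norm v = 1 -> hdot u v = 0 ->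
  l2norm (X *m u) ^+ 2 + l2norm (X *m v) ^+ 2 <=
  sigma X 1 ^+ 2 + sigma X 2 ^+ 2.
Proof.
move=> u1 v1 uv.
have [U [f [i0 [[UU _] fX f0 f1 f2]]]] := singular_decomposition X.
pose w i := normc ((U *m u) i 0) ^+ 2 + normc ((U *m v) i 0) ^+ 2.
have w1 i : w i <= 1.
  by apply: bessel_coord; rewrite ?unitary_l2norm ?unitary_hdot.
have w0 i : 0 <= w i by rewrite addr_ge0 ?sqr_ge0.
have ws : \sum_i w i = 2.
  by rewrite big_split /= -!l2norm_sq !unitary_l2norm // u1 v1 expr1n.
have -> : l2norm (X *m u) ^+ 2 + l2norm (X *m v) ^+ 2 = \sum_i f i ^+ 2 * w i.
  by rewrite !fX -big_split; apply: eq_bigr => i _; rewrite /w mulrDr.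
rewrite (bigD1 i0) //= in ws; rewrite (bigD1 i0) //= f0.
have h : \sum_(i | i != i0) f i ^+ 2 * w i <=
    sigma X 2 ^+ 2 * \sum_(i | i != i0) w i.
  rewrite mulr_sumr; apply: ler_sum => i ii0; rewrite ler_wpM2r //.
  have /andP[fi _] := f1 i.
  by rewrite ler_pXn2r ?nnegrE ?f2 // (le_trans fi) ?f2.
have s21 : sigma X 2 ^+ 2 <= sigma X 1 ^+ 2.
  have /andP[s20 s21] := sigma2_le X.
  by rewrite ler_pXn2r ?nnegrE // (le_trans s20).
have := w1 i0; nra.
Qed.

Lemma l2norm_le_sigma1 (R : realType) (n : nat) (X : 'M[R[i]]_n.+1) v :
  l2norm (X *m v) ^+ 2 <= sigma X 1 ^+ 2 * l2norm v ^+ 2.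
Proof.
have [U [f [i0 [[UU _] fX f0 f1 f2]]]] := singular_decomposition X.
rewrite fX -(unitary_l2norm v UU) l2norm_sq mulr_sumr; apply: ler_sum => i _.
rewrite ler_wpM2r ?sqr_ge0 //; have /andP[fi fi1] := f1 i.
by rewrite ler_pXn2r ?nnegrE // (le_trans fi).
Qed.

(** The norm is attained at the right singular vector for the largest singular
    value. *)
Lemma norm_1_opnorm (R : realType) (n : nat) (X : 'M[R[i]]_n) :
  norm_1 X = opnorm X.
Proof.
case: n X => [|n] X.
  have -> : norm_1 X = 0.
    by rewrite /norm_1 /sigma nth_default // (singular_values_sorted X).2.
  apply/eqP; rewrite eq_le opnorm_ge0 opnorm_le // => v _.
  by rewrite (flatmx0 (X *m v)) l2norm0.
have [U [f [i0 [[UU UU'] fX f0 f1 f2]]]] := singular_decomposition X.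
have s0 : 0 <= sigma X 1 by have /andP[fi fi1] := f1 i0; exact: le_trans fi1.
apply/eqP; rewrite eq_le; apply/andP; split.
  pose v : 'cV_n.+1 := U ^t* *m delta_mx i0 0.
  have UvE : U *m v = delta_mx i0 0 by rewrite mulmxA UU' mul1mx.
  have v1 : l2norm v = 1 by rewrite -(unitary_l2norm v UU) UvE l2norm_delta.
  suff -> : norm_1 X = l2norm (X *m v) by rewrite l2norm_le_opnorm // v1.
  apply/eqP; rewrite -(@eqrXn2 _ 2) ?l2norm_ge0 // fX UvE (bigD1 i0) //=.
  rewrite f0 big1 ?mxE ?eqxx ?normc1 ?expr1n ?mulr1 ?addr0 //.
  by move=> i /negPf ii0; rewrite mxE ii0 normc0 expr0n mulr0.
apply: opnorm_le => v v1; rewrite -(@ler_pXn2r _ 2) ?nnegrE ?l2norm_ge0 //.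
apply: le_trans (l2norm_le_sigma1 X v) _.
by rewrite ler_piMr ?sqr_ge0 // -[1](expr1n _ 2) ler_pXn2r ?nnegrE ?l2norm_ge0.
Qed.

(** With [Y = X - y], a unit vector [v] such that [Y v] is orthogonal to [v],
    and [e] along [Y^* v]: removing [y] can only shorten [X v], and the
    component of [X e] along [v] is [|Y^* v|]. *)
Lemma centred_l2norm_le_sigma (R : realType) (n : nat) (X : 'M[R[i]]_n.+1) y v :
  l2norm v = 1 -> hdot v ((X - y%:M) *m v) = 0 ->
  l2norm ((X - y%:M) *m v) ^+ 2 + l2norm ((X - y%:M) ^t* *m v) ^+ 2
    <= sigma X 1 ^+ 2 + sigma X 2 ^+ 2.
Proof.
move=> v1; set Y := X - y%:M => Kv.
have XE w : X *m w = Y *m w + y *: w by rewrite mulmxBl mul_scalar_mx subrK.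
have Yv : l2norm (Y *m v) ^+ 2 <= l2norm (X *m v) ^+ 2.
  rewrite XE l2norm_sqD l2norm_sqZ hdotZr hdotC Kv conjc0 mulr0 /= mulr0 addr0.
  by rewrite lerDl mulr_ge0 ?sqr_ge0.
set c := Y ^t* *m v.
have vc : hdot v c = 0 by rewrite -hdot_adj hdotC Kv conjc0.
(* When [Y^* v = 0] there is no [e], and the top singular value suffices. *)
have [c0|c0] := eqVneq (l2norm c) 0.
  rewrite c0 expr0n addr0 (le_trans Yv) //.
  apply: le_trans (l2norm_le_sigma1 X v) _.
  by rewrite v1 expr1n mulr1 lerDl sqr_ge0.
pose a := l2norm c; pose e := (a^-1)%:C *: c.
have a0 : 0 <= a^-1 by rewrite invr_ge0 l2norm_ge0.
have e1 : l2norm e = 1.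
  by rewrite l2norm_realZ // mulVf.
have ve : hdot v e = 0 by rewrite hdotZr vc mulr0.
have vXe : hdot v (X *m e) = a%:C.
  rewrite XE hdotDr hdotZr ve mulr0 addr0 -[Y]trmxCK -hdot_adj hdotZr hdotvv.
  by rewrite -rmorphM /= expr2 mulrA mulVf // mul1r.
have a2 : normc a%:C ^+ 2 = l2norm c ^+ 2 by rewrite normc_sq expr0n addr0.
have := cauchy_schwarz_unit (X *m e) v1; rewrite vXe a2 => h.
exact: le_trans (lerD Yv h) (ky_fan2 X v1 e1 ve).
Qed.

(** * Optimality of the centre *)

(** The Cartesian modulus makes the change of the centre exact: both [Y] and
    [Y^*] contribute the same first-order term. *)
Lemma l2norm_modulusC_shift (R : realType) (n : nat) (Y : 'M[R[i]]_n) t v :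
  l2norm (modulusC (Y - t%:M) *m v) ^+ 2 = l2norm (modulusC Y *m v) ^+ 2
    - 2 * complex.Re (t^* * hdot v (Y *m v)) + normc t ^+ 2 * l2norm v ^+ 2.
Proof.
have adjE : (Y - t%:M) ^t* = Y ^t* - (t^*)%:M.
  by rewrite linearB /= tr_scalar_mx map_mxB map_scalar_mx.
have shift (A : 'M[R[i]]_n) c : l2norm ((A - c%:M) *m v) ^+ 2 =
    l2norm (A *m v) ^+ 2 + normc c ^+ 2 * l2norm v ^+ 2
    - 2 * complex.Re (c^* * hdot v (A *m v)).
  rewrite mulmxBl mul_scalar_mx -scaleNr l2norm_sqD l2norm_sqZ normcN hdotZr.
  rewrite hdotC; congr (_ + _); case: c (hdot v _) => a b [x y] /=; ring.
have adjK : complex.Re (t^*^* * hdot v (Y ^t* *m v))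
    = complex.Re (t^* * hdot v (Y *m v)).
  rewrite -hdot_adj hdotC; case: (t) (hdot v _) => a b [x y] /=; ring.
have normJ : normc t^* ^+ 2 = normc t ^+ 2.
  by rewrite !normc_sq; case: (t) => a b /=; rewrite sqrrN.
have half (a b c d N K : R) : a = c + N - 2 * K -> b = d + N - 2 * K ->
    2^-1 * (a + b) = 2^-1 * (c + d) - 2 * K + N by move=> -> ->; field.
apply: (etrans (l2norm_modulusC _ _)).
rewrite [X in _ = X - _ + _]l2norm_modulusC.
apply: half; first exact: shift.
by rewrite adjE -adjK -normJ; exact: shift.
Qed.

Lemma l2norm_sq_le_opnorm (R : realType) (n : nat) (G : 'M[R[i]]_n) v :
  l2norm (G *m v) ^+ 2 <= opnorm G ^+ 2 * l2norm v ^+ 2.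
Proof.
have [v0|v0] := eqVneq (l2norm v) 0.
  by rewrite (l2norm_eq0 v0) mulmx0 l2norm0 expr0n mulr0.
have vp : 0 <= (l2norm v)^-1 by rewrite invr_ge0 l2norm_ge0.
have nE (w : 'cV[R[i]]_n) := l2norm_realZ w vp.
have := @l2norm_le_opnorm _ _ G (((l2norm v)^-1)%:C *: v).
rewrite -scalemxAr !nE mulVf // lexx => /(_ isT).
rewrite ler_pdivrMl ?lt_neqAle 1?eq_sym ?v0 ?l2norm_ge0 // => h.
by rewrite -exprMn ler_pXn2r ?nnegrE ?mulr_ge0 ?l2norm_ge0 ?opnorm_ge0 // mulrC.
Qed.

Lemma opnorm_sq_le (R : realType) (n : nat) (G : 'M[R[i]]_n.+1) c :
  (forall v, l2norm v = 1 -> l2norm (G *m v) ^+ 2 <= c) -> opnorm G ^+ 2 <= c.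
Proof.
move=> Gc.
have e1 := @l2norm_delta R n.+1 0.
have c0 : 0 <= c by apply: le_trans (Gc _ e1); exact: sqr_ge0.
rewrite -[leRHS](sqr_sqrtr c0) ler_pXn2r ?nnegrE ?opnorm_ge0 ?sqrtr_ge0 //.
apply: opnorm_le => v v1; have [v0|v0] := eqVneq (l2norm v) 0.
  by rewrite (l2norm_eq0 v0) mulmx0 l2norm0 sqrtr_ge0.
have vp : 0 <= (l2norm v)^-1 by rewrite invr_ge0 l2norm_ge0.
have nE (w : 'cV[R[i]]_n.+1) := l2norm_realZ w vp.
have := Gc (((l2norm v)^-1)%:C *: v).
rewrite -scalemxAr !nE mulVf // => /(_ erefl) h.
have {}h : (l2norm v)^-1 * l2norm (G *m v) <= Num.sqrt c.
  rewrite -(@ler_pXn2r _ 2) ?nnegrE ?mulr_ge0 ?sqrtr_ge0 ?l2norm_ge0 //.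
  by rewrite (sqr_sqrtr c0).
move: h; rewrite ler_pdivrMl ?lt_neqAle 1?eq_sym ?v0 ?l2norm_ge0 //.
move=> /le_trans; apply.
by rewrite ler_piMl ?sqrtr_ge0.
Qed.

(** If the conclusion fails for [z], then compactness gives a [d > 0] such that
    every unit vector [v] either falls short of the squared norm [lam] by at
    least [d], or satisfies [Re (z^* K v) >= d]. Moving the centre by a small
    multiple [e] of [z] then decreases the squared norm: in the first case the
    gap [d] absorbs the change, in the second the first-order term is
    negative. *)
Lemma optimal_direction (R : realType) (n : nat) (Y : 'M[R[i]]_n.+1) z :
  (forall t, opnorm (modulusC Y) <= opnorm (modulusC (Y - t%:M))) ->
  exists p, [/\ l2norm p = 1,
    opnorm (modulusC Y) ^+ 2 <= l2norm (modulusC Y *m p) ^+ 2 &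
    complex.Re (z^* * hdot p (Y *m p)) <= 0].
Proof.
move=> Ymin; set lam := opnorm _ ^+ 2.
pose f v := lam - l2norm (modulusC Y *m v) ^+ 2.
pose k v := complex.Re (z^* * hdot v (Y *m v)).
have fc : cV_continuous f.
  apply: cV_continuous_sub; first exact: cV_continuous_cst.
  exact: cV_continuous_l2norm_sq.
have kc : cV_continuous k.
  have : cV_continuousC (fun v => z^* * hdot v (Y *m v)); last by case.
  apply: cV_continuousC_mul; first exact: cV_continuousC_cst.
  by have := cV_continuousC_hdot 1%:M Y; under eq_fun do rewrite mul1mx.
have e1 := @l2norm_delta R n.+1 0.
have [|p [p1 _ pmin]] :=
  sphere_min_exists (cV_continuous_max fc kc) (@cV_continuous_cst _ _ 0).
  by exists (delta_mx 0 0).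
have [|d0] := leP (Num.max (f p) (k p)) 0.
  rewrite ge_max subr_le0 => /andP[fp kp]; by exists p.
move: d0 pmin; set d := Num.max _ _ => d0 pmin; exfalso.
pose m := normc z ^+ 2; have m0 : 0 <= m by exact: sqr_ge0.
have lam0 : 0 <= lam by exact: sqr_ge0.
(* The step [e = d / D] is at most [1 / 2], and small enough for the new
   squared norm to be at most [lam - e * d] in both cases. *)
pose D := 2 * (d + lam + 2 * m); have D0 : 0 < D by rewrite /D; lra.
pose e := d / D; have e0 : 0 < e by rewrite divr_gt0.
have eD : e * D = d by rewrite mulfVK ?gt_eqF.
have shiftE v (c : R) : l2norm v = 1 ->
    l2norm (modulusC (Y - (c%:C * z)%:M) *m v) ^+ 2 =
    lam - f v - 2 * c * k v + c ^+ 2 * m.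
  move=> v1; rewrite l2norm_modulusC_shift v1 expr1n mulr1 /f /k /m !normc_sq.
  rewrite subKr; case: (z) (hdot v (Y *m v)) => a b [a' b'] /=; ring.
have : lam <= lam - e * d.
  apply: le_trans (_ : opnorm (modulusC (Y - (e%:C * z)%:M)) ^+ 2 <= _).
    by rewrite ler_pXn2r ?nnegrE ?opnorm_ge0.
  apply: opnorm_sq_le => v v1; rewrite shiftE //.
  have f0 : 0 <= f v.
    rewrite subr_ge0 (le_trans (l2norm_sq_le_opnorm _ _)) //.
    by rewrite v1 expr1n mulr1.
  (* Moving the centre by [- z] instead bounds [k v] below, which is needed in
     the case where only [f v >= d] is known. *)
  have := sqr_ge0 (l2norm (modulusC (Y - ((-1)%:C * z)%:M) *m v)).
  rewrite shiftE //; have := pmin v v1 (lexx _); rewrite le_max.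
  move: (f v) (k v) f0 => F K F0 /orP[dF|dK] h; rewrite /D in eD; nra.
nra.
Qed.

(** The left side is [|z (1 + e rho) + e^2 S kappa|^2], with [|z|^2 = m],
    [|kappa|^2 = k] and [Re (z^* kappa) = g]; the right side is the same for
    [rho = 2 nu] and [kappa = z]. The sign of [e] is chosen so that the
    first-order terms do not hurt; then at second order the right side gains
    [2 m S e^2], while [g <= 0] contributes nothing positive on the left. *)
Lemma second_order_escape (R : realType) (m S g k nu rho : R) :
  0 < m -> 0 < S -> g <= 0 -> 0 <= k ->
  exists e, m * (1 + e * rho) ^+ 2 + 2 * (1 + e * rho) * (e ^+ 2 * S * g)
    + e ^+ 4 * S ^+ 2 * k < m * (1 + 2 * e * nu + e ^+ 2 * S) ^+ 2.
Proof.
move=> m0 S0 g0 k0.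
(* [t = D^-1] makes [t * |rho|] at most [1 / 2], [t * |nu|] at most [1 / 8]
   and the fourth-order term at most half of the second-order gain. *)
pose D := 1 + 2 * `|rho| + 8 * `|nu| + 2 * S * k / m.
have Sk0 : 0 <= 2 * S * k / m by rewrite divr_ge0 ?mulr_ge0 // ltW.
have r0 := normr_ge0 rho; have n0 := normr_ge0 nu.
have D1 : 1 <= D by rewrite /D; lra.
pose t := D^-1; have t0 : 0 < t by rewrite invr_gt0; lra.
have tD : t * D = 1 by rewrite mulVf ?gt_eqF //; lra.
have t1 : t <= 1 by nra.
have tr : t * `|rho| <= 1 / 2 by rewrite /D in tD; nra.
have tn : t * `|nu| <= 1 / 8 by rewrite /D in tD; nra.
have tk : t ^+ 2 * (S * k) <= m / 2.
  have : t * (2 * S * k / m) <= 1 by rewrite /D in tD; nra.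
  rewrite mulrA ler_pdivrMr // => h.
  have h0 : 0 <= S * k by rewrite mulr_ge0 // ltW.
  have : t * (S * k) <= m / 2 by lra.
  nra.
have [e [et er]] : exists e, `|e| = t /\ e * rho <= e * (2 * nu).
  have [h|h] := leP rho (2 * nu).
    by exists t; rewrite gtr0_norm // ler_pM2l.
  by exists (- t); rewrite normrN gtr0_norm // !mulNr lerN2 ler_pM2l // ltW.
have e2 : e ^+ 2 = t ^+ 2 by rewrite -et real_normK ?num_real.
exists e.
have : `|e * rho| <= 1 / 2 by rewrite normrM et.
have : `|e * nu| <= 1 / 8 by rewrite normrM et.
rewrite !ler_norml => /andP[n1 n2] /andP[r1 r2].
have e4 : e ^+ 4 * S ^+ 2 * k = (t ^+ 2 * S) * (t ^+ 2 * (S * k)).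
  by rewrite -e2; ring.
rewrite e4 e2.
have -> : 1 + 2 * e * nu = 1 + e * (2 * nu) by ring.
move: er n1 n2 r1 r2; have -> : e * nu = (e * (2 * nu)) / 2 by field.
move: (e * rho) (e * (2 * nu)) => a b ab b1 b2 a1 a2.
have T0 : 0 < t ^+ 2 * S by rewrite mulr_gt0 // exprn_gt0.
move: (t ^+ 2 * S) T0 tk => T T0; move: (t ^+ 2 * (S * k)) => U tk.
have h1 : 2 * (1 + a) * (T * g) <= 0.
  by apply: mulr_ge0_le0; [lra|apply: mulr_ge0_le0; lra].
have h2 : T * U <= T * (m / 2) by rewrite ler_pM2l.
have h3 : (1 + a) ^+ 2 <= (1 + b) ^+ 2 by nra.
have h4 : m * (1 + a) ^+ 2 <= m * (1 + b) ^+ 2 by rewrite ler_pM2l.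
have h5 : m * T <= m * (T * (1 + b) * 2).
  by rewrite ler_pM2l //; nra.
have h6 : 0 < m * T by rewrite mulr_gt0.
have h7 : 0 <= m * T ^+ 2 by rewrite mulr_ge0 ?sqr_ge0 // ltW.
have -> : m * (1 + b + T) ^+ 2 =
    m * (1 + b) ^+ 2 + m * (T * (1 + b) * 2) + m * T ^+ 2.
  by ring.
lra.
Qed.

(** The defect [opnorm G ^+ 2 * |v|^2 - |G v|^2] is a nonnegative quadratic
    form, so by the parallelogram law its zeros are closed under addition. *)
Lemma opnorm_attained_add (R : realType) (n : nat) (G : 'M[R[i]]_n) u v :
  l2norm (G *m u) ^+ 2 = opnorm G ^+ 2 * l2norm u ^+ 2 ->
  l2norm (G *m v) ^+ 2 = opnorm G ^+ 2 * l2norm v ^+ 2 ->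
  l2norm (G *m (u + v)) ^+ 2 = opnorm G ^+ 2 * l2norm (u + v) ^+ 2.
Proof.
move=> Gu Gv; apply/eqP; rewrite eq_le l2norm_sq_le_opnorm /=.
have := l2norm_sq_le_opnorm G (u + (-1) *: v).
rewrite !mulmxDr -scalemxAr !l2norm_sqD !l2norm_sqZ !hdotZr Gu Gv.
rewrite normcN normc1 expr1n !mul1r.
have ReN (x : R[i]) : complex.Re (-1 * x) = - complex.Re x.
  by case: x => a b; rewrite mulN1r.
rewrite !ReN; lra.
Qed.

(** The map sending [s] to [Im (z^* (s A + s^* B))] is a real linear functional
    on a real plane, hence it has a nonzero zero; there [s A + s^* B] is a real
    multiple of [z]. *)
Lemma aligned_phase (R : realType) (z A B : R[i]) : 0 < normc z ^+ 2 ->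
  exists s : R[i], 0 < normc s ^+ 2 /\
    exists rho : R, s * A + s^* * B = rho%:C * z.
Proof.
move=> z0; pose al := complex.Im (z^* * (A + B)).
pose be := complex.Re (z^* * (A - B)).
have [s [s0 sIm]] : exists s : R[i], 0 < normc s ^+ 2 /\
    complex.Im (z^* * (s * A + s^* * B)) = 0.
  have [al0|al0] := eqVneq al 0.
    exists 1; rewrite normc1 expr1n ltr01; split=> //.
    by rewrite rmorph1 !mul1r.
  exists (be +i* - al); split.
    by rewrite normc_sq /= ltr_wpDl ?sqr_ge0 // exprn_even_gt0 // oppr_eq0.
  rewrite /al /be.
  by case: (z) A B {al be al0} => [z1 z2] [a1 a2] [b1 b2] /=; ring.
exists s; split=> //.
exists (complex.Re (z^* * (s * A + s^* * B)) / normc z ^+ 2).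
move: z0 sIm; rewrite normc_sq.
case: z (s * A + s^* * B) {al be} => [z1 z2] [l1 l2] /=.
move=> /lt0r_neq0 z0 sIm; apply/eqP; rewrite eq_complex /= !mul0r subr0 addr0.
apply/andP; split; apply/eqP; apply: (mulIf z0); rewrite mulrAC divfK //;
  apply: subr0_eq.
- by rewrite -[RHS](mulr0 (- z2)) -sIm; ring.
- by rewrite -[RHS](mulr0 z1) -sIm; ring.
Qed.

(** A minimizer [v] of [|K v|] among the unit vectors attaining the norm of
    [modulusC Y] has [K v = 0]. Otherwise let [p] be a vector in that set with
    [Re ((K v)^* K p) <= 0]. Along [v + e s p], which still attains the norm
    after normalization, the first-order term of [K] is parallel to [K v] for
    a suitable [s], and the second-order term points away from [K v]. *)
Lemma optimal_vector (R : realType) (n : nat) (Y : 'M[R[i]]_n.+1) :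
  (forall t, opnorm (modulusC Y) <= opnorm (modulusC (Y - t%:M))) ->
  exists v, [/\ l2norm v = 1,
    l2norm (modulusC Y *m v) ^+ 2 = opnorm (modulusC Y) ^+ 2 &
    hdot v (Y *m v) = 0].
Proof.
move=> Ymin; set G := modulusC Y.
pose K v := hdot v (Y *m v).
have Kc : cV_continuousC K.
  by have := cV_continuousC_hdot 1%:M Y; under eq_fun do rewrite mul1mx.
pose g v := complex.Re (K v) ^+ 2 + complex.Im (K v) ^+ 2.
have gc : cV_continuous g.
  by case: Kc => ? ?; apply: cV_continuous_add; exact: cV_continuous_mul.
pose f v := opnorm G ^+ 2 - l2norm (G *m v) ^+ 2.
have fc : cV_continuous f.
  apply: cV_continuous_sub; first exact: cV_continuous_cst.
  exact: cV_continuous_l2norm_sq.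
have topE v : l2norm v = 1 -> f v <= 0 ->
    l2norm (G *m v) ^+ 2 = opnorm G ^+ 2 * l2norm v ^+ 2.
  move=> v1; rewrite subr_le0 => fv; apply/eqP.
  by rewrite eq_le l2norm_sq_le_opnorm v1 expr1n mulr1.
have [|v [v1 fv vmin]] := sphere_min_exists gc fc.
  have [p [p1 fp _]] := optimal_direction 0 Ymin.
  by exists p => //; rewrite subr_le0.
have vtop := topE v v1 fv.
exists v; split; rewrite ?vtop ?v1 ?expr1n ?mulr1 //.
(* Minimality of [v], freed from normalization by homogeneity. *)
have gmin w : l2norm (G *m w) ^+ 2 = opnorm G ^+ 2 * l2norm w ^+ 2 ->
    g v * (l2norm w ^+ 2) ^+ 2 <= g w.
  move=> wtop; have [w0|w0] := eqVneq (l2norm w) 0.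
    by rewrite w0 !expr0n mulr0 addr_ge0 ?sqr_ge0.
  pose c := (l2norm w)^-1.
  have c0 : 0 <= c by rewrite invr_ge0 l2norm_ge0.
  have nE (x : 'cV[R[i]]_n.+1) := l2norm_realZ x c0.
  have cw : c * l2norm w = 1 by rewrite mulVf.
  have gE : g (c%:C *: w) = (c ^+ 2) ^+ 2 * g w.
    rewrite /g /K -scalemxAr hdotZl hdotZr; case: (hdot w _) => a b /=; ring.
  have := vmin (c%:C *: w); rewrite nE => /(_ cw).
  rewrite gE /f -scalemxAr nE exprMn wtop mulrCA -exprMn cw expr1n mulr1 subrr.
  move=> /(_ (lexx _)); rewrite -(@ler_pM2r _ ((l2norm w ^+ 2) ^+ 2)).
    move=> /le_trans; apply; rewrite mulrAC -!exprMn cw !expr1n mul1r //.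
  by rewrite !exprn_gt0 // lt_neqAle eq_sym w0 l2norm_ge0.
apply/eqP; rewrite -/(K v); apply: contraTT isT => Kv0.
have m0 : 0 < g v.
  move: Kv0; rewrite eq_complex negb_and /g => /orP[h|h].
    by rewrite ltr_pwDl ?sqr_ge0 // exprn_even_gt0.
  by rewrite ltr_wpDl ?sqr_ge0 // exprn_even_gt0.
have [p [p1 fp kp]] := optimal_direction (K v) Ymin.
have ptop : l2norm (G *m p) ^+ 2 = opnorm G ^+ 2 * l2norm p ^+ 2.
  by apply: topE => //; rewrite subr_le0.
pose A := hdot v (Y *m p); pose B := hdot p (Y *m v).
have wtop a : l2norm (G *m (v + a *: p)) ^+ 2 =
    opnorm G ^+ 2 * l2norm (v + a *: p) ^+ 2.
  apply: opnorm_attained_add => //.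
  by rewrite -scalemxAr !l2norm_sqZ ptop mulrCA.
have KE a : K (v + a *: p) = K v + (a * A + a^* * B) + a^* * a * K p.
  rewrite /K /A /B mulmxDr -scalemxAr hdotDl !hdotDr !hdotZl !hdotZr.
  by rewrite mulrA !addrA.
have [|s [s0 [rho LE]]] := @aligned_phase _ (K v) A B.
  by rewrite normc_sq.
have [e] := second_order_escape (complex.Re (hdot v (s *: p))) rho m0 s0 kp
  (addr_ge0 (sqr_ge0 (complex.Re (K p))) (sqr_ge0 (complex.Im (K p)))).
rewrite ltNge => /negP; case.
have := gmin _ (wtop (e%:C * s)).
rewrite -scalerA l2norm_sqD v1 l2norm_sqZ l2norm_sqZ p1.
have -> : g (v + e%:C *: (s *: p)) =
    g v * (1 + e * rho) ^+ 2
    + 2 * (1 + e * rho) * (e ^+ 2 * normc s ^+ 2 * complex.Re ((K v)^* * K p))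
    + e ^+ 4 * (normc s ^+ 2) ^+ 2
      * (complex.Re (K p) ^+ 2 + complex.Im (K p) ^+ 2).
  rewrite scalerA /g KE.
  have -> : e%:C * s * A + (e%:C * s)^* * B = (e * rho)%:C * K v.
    rewrite (rmorphM (real_complex R)) -[RHS]mulrA -LE.
    by case: (s) (A) (B) => [s1 s2] [a1 a2] [b1 b2];
      apply/eqP; rewrite eq_complex /=; apply/andP; split; apply/eqP; ring.
  rewrite normc_sq; case: (K v) (K p) (s) => [z1 z2] [k1 k2] [s1 s2] /=; ring.
have -> : normc e%:C ^+ 2 = e ^+ 2 by rewrite normc_sq expr0n addr0.
rewrite hdotZr.
rewrite Re_realM.
move=> h; apply: le_trans h; rewrite le_eqVlt; apply/orP; left; apply/eqP.
ring.
Qed.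

Lemma radiusL_le (R : realType) (n : nat) (X : 'M[R[i]]_n) :
  radiusL X <= opnorm X.
Proof.
have [_ _ /(_ 0)] := radiusL_min X; rewrite subr_0mx => /le_trans; apply.
by apply: opnorm_le => v v1; rewrite l2norm_modulusL l2norm_le_opnorm.
Qed.

Lemma radiusC_le (R : realType) (n : nat) (X : 'M[R[i]]_n) :
  radiusC X <= (Num.sqrt 2)^-1 * norm_2_2 X.
Proof.
have rhs0 : 0 <= (Num.sqrt 2)^-1 * norm_2_2 X.
  by rewrite mulr_ge0 ?invr_ge0 ?sqrtr_ge0.
have [y yE ymin] := radiusC_min X.
case: n X rhs0 y yE ymin => [|n] X rhs0 y yE ymin.
  rewrite yE; apply: opnorm_le => v _.
  by rewrite (flatmx0 (_ *m v)) l2norm0.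
have [t|v [v1 vtop Kv]] := @optimal_vector _ _ (X - y%:M).
  have tE : X - y%:M - t%:M = X - (y + t)%:M by rewrite raddfD /= opprD addrA.
  by have := ymin (y + t); rewrite yE tE.
have sq : ((Num.sqrt 2)^-1 * norm_2_2 X) ^+ 2
    = 2^-1 * (sigma X 1 ^+ 2 + sigma X 2 ^+ 2).
  rewrite exprMn exprVn (sqr_sqrtr (ler0n _ 2)) sqr_sqrtr //.
  by rewrite addr_ge0 ?sqr_ge0.
rewrite -(@ler_pXn2r _ 2) ?nnegrE ?yE ?opnorm_ge0 // sq -vtop l2norm_modulusC.
rewrite ler_pM2l ?invr_gt0 //; exact: centred_l2norm_le_sigma.
Qed.

Theorem theorem12 (R : realType) (n : nat) (X : 'M[R[i]]_n) :
  (radiusL X <= norm_1 X /\ norm_1 X = opnorm X) /\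
  radiusC X <= (Num.sqrt 2)^-1 * norm_2_2 X.
Proof.
split; last exact: radiusC_le.
by rewrite norm_1_opnorm; split; first exact: radiusL_le.
Qed.
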